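(* Let $(M,g)$ be a 3-dimensional Riemannian manifold and let $p\in M$. Let $\lambda$ and $\mu$ be eigenvalues of the Ricci tensor at $p$ associated with eigenvectors $x$ and $y$ in $T_pM$ respectively, i.e. $R_{ac}x^c=\lambda\, g_{ac}x^c$ and $R_{ac}y^c=\mu\, g_{ac}y^c$, where $\langle x,x\rangle=\langle y,y\rangle=1$ and $\langle x,y\rangle=0$. Then $(\zeta,x,y)$ with $$\zeta=\lambda+\mu-\frac{R}{2}$$ is an eigentriple of the modified M-eigenproblem at $p$, where $R$ is the scalar curvature at $p$.
   Context: Let $\nabla$ be the Levi-Civita connection of $g$ and $\langle\cdot,\cdot\rangle=g$. Convention: $R(X,Y)=[\nabla_X,\nabla_Y]-\nabla_{[X,Y]}$, $R(W,Z,X,Y)=\langle W,R(X,Y)Z\rangle$, and in local coordinates $R_{ijkl}=R(\partial_i,\partial_j,\partial_k,\partial_l)$ (summation convention is used). The Ricci tensor is $R_{ik}=g^{hj}R_{hijk}$ and the scalar curvature is $R=g^{ik}R_{ik}$ (so the unit round sphere has positive Ricci and scalar curvature). Modified M-eigenproblem: $(\theta,u,v)$ with $\theta\in\mathbb{R}$ and $u,v\in T_pM$ is an eigentriple if $$R(v,u)u=\theta v,\qquad R(u,v)v=\theta u,\qquad \langle u,u\rangle=\langle v,v\rangle=1,\qquad \langle u,v\rangle=0.$$ *)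

(* Defs.v *)
From HB Require Import structures.
From mathcomp Require Import all_boot all_order all_algebra.
From mathcomp Require Import all_classical all_reals all_analysis.

Set Implicit Arguments.
Unset Strict Implicit.
Unset Printing Implicit Defensive.

Import Order.TTheory GRing.Theory Num.Theory.
Import numFieldNormedType.Exports.

Local Open Scope classical_set_scope.
Local Open Scope ring_scope.

(* Vectors are row vectors, so the differential of f at x is
   v |-> v *m 'J f x, and <u, v> = u *m G *m v^T. *)

Section SmoothFunctions.
Variables (R : realType) (n : nat).

Definition coord_vec (i : 'I_n) : 'rV[R]_n := delta_mx 0 i.

(* C^k on V (used for open V only): all iterated partial derivatives of order
   at most k exist and are continuous on V. *)
Fixpoint Ck (W : normedModType R) (k : nat) (V : set 'rV[R]_n)
    (f : 'rV[R]_n -> W) : Prop :=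
  (forall x, V x -> {for x, continuous f}) /\
  match k with
  | 0 => True
  | k'.+1 => forall i : 'I_n,
      (forall x, V x -> derivable f x (coord_vec i)) /\
      Ck k' V (fun x => 'D_(coord_vec i) f x)
  end.

Definition smooth (W : normedModType R) (V : set 'rV[R]_n)
    (f : 'rV[R]_n -> W) : Prop := forall k, Ck k V f.

End SmoothFunctions.

(* A smooth n-manifold: a Hausdorff second countable space with a C^oo atlas.
   [chart_map c] and [chart_inv c] are total functions, meaningful only on
   [chart_dom c] and on its image. *)
Record smooth_atlas (R : realType) (n : nat) (M : topologicalType) :=
  SmoothAtlas {
  chart : Type;
  chart_dom : chart -> set M;
  chart_map : chart -> M -> 'rV[R]_n;
  chart_inv : chart -> 'rV[R]_n -> M;
  atlas_hausdorff : hausdorff_space M;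
  atlas_second_countable : @second_countable M;
  atlas_cover : forall p, exists c, chart_dom c p;
  chart_dom_open : forall c, open (chart_dom c);
  chart_img_open : forall c, open (chart_map c @` chart_dom c);
  chart_mapK : forall c p, chart_dom c p -> chart_inv c (chart_map c p) = p;
  chart_map_continuous : forall c p, chart_dom c p ->
    {for p, continuous (chart_map c)};
  chart_inv_continuous : forall c x, (chart_map c @` chart_dom c) x ->
    {for x, continuous (chart_inv c)};
  transition_smooth : forall c d,
    smooth (chart_map c @` (chart_dom c `&` chart_dom d))
           (chart_map d \o chart_inv c) }.

Arguments chart_dom {R n M A} : rename.
Arguments chart_map {R n M A} : rename.
Arguments chart_inv {R n M A} : rename.

Definition chart_img (R : realType) (n : nat) (M : topologicalType)
    (A : smooth_atlas R n M) (c : chart A) : set 'rV[R]_n :=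
  chart_map c @` chart_dom c.

Definition inner (R : realType) (n : nat) (G : 'M[R]_n) (u v : 'rV[R]_n) : R :=
  (u *m G *m v^T) 0 0.

(* [metric_comp c x] is the Gram matrix g_ij of the coordinate frame of the
   chart c, as a function of the coordinates x; [metric_change] is the
   transformation law of a (0,2)-tensor. *)
Record riemannian_metric (R : realType) (n : nat) (M : topologicalType)
    (A : smooth_atlas R n M) := RiemannianMetric {
  metric_comp :> chart A -> 'rV[R]_n -> 'M[R]_n;
  metric_smooth : forall c i j,
    smooth (chart_img c) (fun x => metric_comp c x i j : R^o);
  metric_sym : forall c x, chart_img c x ->
    (metric_comp c x)^T = metric_comp c x;
  metric_pos : forall c x u, chart_img c x -> u != 0 ->
    0 < inner (metric_comp c x) u u;
  metric_change : forall c d p, chart_dom c p -> chart_dom d p ->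
    let J := 'J (chart_map d \o chart_inv c) (chart_map c p) in
    metric_comp c (chart_map c p) =
      J *m metric_comp d (chart_map d p) *m J^T }.

(* Differential geometry on the coordinate domain V of a chart.  A vector field
   on V is given by its components in the coordinate frame; only its values on
   V are meaningful. *)
Section CoordinateDomain.
Variables (R : realType) (n : nat).

Definition vfield : Type := 'rV[R]_n -> 'rV[R]_n.

Definition lie_bracket (X Y : vfield) : vfield :=
  fun x => 'D_(X x) Y x - 'D_(Y x) X x.

Record affine_connection (V : set 'rV[R]_n)
    (nabla : vfield -> vfield -> vfield) : Prop := AffineConnection {
  conn_smooth : forall X Y, smooth V X -> smooth V Y -> smooth V (nabla X Y);
  conn_ext : forall X X' Y Y', smooth V X -> smooth V X' ->
    smooth V Y -> smooth V Y' ->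
    (forall x, V x -> X x = X' x) -> (forall x, V x -> Y x = Y' x) ->
    forall x, V x -> nabla X Y x = nabla X' Y' x;
  conn_addl : forall X X' Y, smooth V X -> smooth V X' -> smooth V Y ->
    forall x, V x ->
    nabla (fun z => X z + X' z) Y x = nabla X Y x + nabla X' Y x;
  conn_scalel : forall (f : 'rV[R]_n -> R^o) X Y,
    smooth V f -> smooth V X -> smooth V Y -> forall x, V x ->
    nabla (fun z => f z *: X z) Y x = f x *: nabla X Y x;
  conn_addr : forall X Y Y', smooth V X -> smooth V Y -> smooth V Y' ->
    forall x, V x ->
    nabla X (fun z => Y z + Y' z) x = nabla X Y x + nabla X Y' x;
  conn_leibniz : forall (f : 'rV[R]_n -> R^o) X Y,
    smooth V f -> smooth V X -> smooth V Y -> forall x, V x ->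
    nabla X (fun z => f z *: Y z) x =
      'D_(X x) f x *: Y x + f x *: nabla X Y x }.

Record levi_civita (V : set 'rV[R]_n) (g : 'rV[R]_n -> 'M[R]_n)
    (nabla : vfield -> vfield -> vfield) : Prop := LeviCivita {
  lc_connection : affine_connection V nabla;
  lc_torsion_free : forall X Y, smooth V X -> smooth V Y -> forall x, V x ->
    nabla X Y x - nabla Y X x = lie_bracket X Y x;
  lc_metric : forall X Y Z, smooth V X -> smooth V Y -> smooth V Z ->
    forall x, V x ->
    'D_(X x) (fun z => inner (g z) (Y z) (Z z) : R^o) x =
      inner (g x) (nabla X Y x) (Z x) + inner (g x) (Y x) (nabla X Z x) }.

Variables (g : 'rV[R]_n -> 'M[R]_n) (nabla : vfield -> vfield -> vfield).

Definition curvature (X Y Z : vfield) : vfield :=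
  fun x => nabla X (nabla Y Z) x - nabla Y (nabla X Z) x
           - nabla (lie_bracket X Y) Z x.

(* R(u,v)w for tangent vectors u, v, w at x.  The curvature is a tensor, so any
   extension to vector fields may be used; we take the extension with constant
   components in the coordinate frame. *)
Definition curvature_at (x u v w : 'rV[R]_n) : 'rV[R]_n :=
  curvature (fun=> u) (fun=> v) (fun=> w) x.

(* R(W,Z,X,Y) = <W, R(X,Y)Z>; note the argument order, which makes the Ricci
   tensor of the round sphere positive. *)
Definition riemann (x W Z X Y : 'rV[R]_n) : R :=
  inner (g x) W (curvature_at x X Y Z).

Definition riemann_comp (x : 'rV[R]_n) (i j k l : 'I_n) : R :=
  riemann x (coord_vec R i) (coord_vec R j) (coord_vec R k) (coord_vec R l).

Definition ricci (x : 'rV[R]_n) (i k : 'I_n) : R :=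
  \sum_(h < n) \sum_(j < n) invmx (g x) h j * riemann_comp x h i j k.

Definition scalar_curvature (x : 'rV[R]_n) : R :=
  \sum_(i < n) \sum_(k < n) invmx (g x) i k * ricci x i k.

Definition ricci_eigen (x : 'rV[R]_n) (lambda : R) (v : 'rV[R]_n) : Prop :=
  v != 0 /\
  forall a : 'I_n, \sum_(c < n) ricci x a c * v 0 c =
                   lambda * \sum_(c < n) g x a c * v 0 c.

Definition M_eigentriple (x : 'rV[R]_n) (theta : R) (u v : 'rV[R]_n) : Prop :=
  [/\ curvature_at x v u u = theta *: v,
      curvature_at x u v v = theta *: u,
      inner (g x) u u = 1,
      inner (g x) v v = 1 &
      inner (g x) u v = 0].

End CoordinateDomain.

(* Main.v *)
Require Import Defs.
From mathcomp Require Import all_boot all_order all_algebra.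
From mathcomp Require Import all_classical all_reals all_analysis.
From mathcomp Require Import lra.

Set Implicit Arguments.
Unset Strict Implicit.
Unset Printing Implicit Defensive.

Import Order.TTheory GRing.Theory Num.Theory.
Import numFieldNormedType.Exports.
Local Open Scope ring_scope.

(* Only the multilinearity of <W,R(X,Y)Z> and its skew-symmetry in (X,Y) and in
   (W,Z) are used, not the Bianchi identity.
   Complete x, y to an orthonormal basis x, y, z.  By the eigenvector equations
   Ric(z,x) = Ric(z,y) = 0, and in dimension 3 each of these traces has a single
   nonzero term, which gives <z,R(y,x)x> = <z,R(x,y)y> = 0.  So R(y,x)x = K y and
   R(x,y)y = K x with K the sectional curvature of (x,y).  Writing Ric(x,x),
   Ric(y,y) and the scalar curvature as sums of sectional curvatures gives
   K = lambda + mu - R/2.  Skew-symmetry in (W,Z) comes from applying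
   [d_i, d_j] = 0 to the function <W,W> for W of constant components. *)

Lemma subrACA (Z : zmodType) (a b c d : Z) :
  a - b - (c - d) = a - c - (b - d).
Proof. by rewrite !opprB addrACA [RHS]addrACA [- b - c]addrC. Qed.

(** * Symmetry of mixed directional derivatives *)

Section Schwarz.
Local Open Scope classical_set_scope.
Local Open Scope ring_scope.
Variables (R : realType) (V : normedModType R).
Implicit Types (f : V -> R^o) (a u v x : V).

Lemma growth_rate_translate f a u x :
  (fun h : R => h^-1 *: (((fun y => f (y + a)) \o shift x) (h *: u) - f (x + a))) =
  (fun h : R => h^-1 *: ((f \o shift (x + a)) (h *: u) - f (x + a))).
Proof. by apply/funext => h /=; rewrite addrA. Qed.

Lemma derivable_translate f a u x :
  derivable (fun y => f (y + a)) x u <-> derivable f (x + a) u.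
Proof. by rewrite /derivable growth_rate_translate. Qed.

Lemma derive_translate f a u x :
  'D_u (fun y => f (y + a)) x = 'D_u f (x + a).
Proof. by rewrite /derive growth_rate_translate. Qed.

(** The difference quotient of the restriction to the line, taken at [s], is literally that of [f]
    at [a + s *: v] in direction [v]. This reduces directional derivatives to one real variable,
    where the mean value theorem is available. *)
Lemma derivable_line f a v (s : R) : derivable f (a + s *: v) v ->
  is_derive s (1 : R^o) (fun t : R^o => f (a + t *: v) : R^o) ('D_v f (a + s *: v)).
Proof.
have E : (fun h : R => h^-1 *:
      (((fun t : R^o => f (a + t *: v) : R^o) \o shift (s : R^o)) (h *: (1 : R^o)) - f (a + s *: v))) =
    (fun h : R => h^-1 *: ((f \o shift (a + s *: v)) (h *: v) - f (a + s *: v))).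
  apply/funext => h /=; congr (_ *: (f _ - _)).
  by rewrite [h%:A]mulr1 scalerDl addrCA.
move=> df; split; first by rewrite /derivable E.
by rewrite /derive E.
Qed.

Lemma MVT_line f a v (h : R) : 0 < h ->
  (forall s, 0 <= s <= h -> derivable f (a + s *: v) v) ->
  exists2 s, 0 <= s <= h & f (a + h *: v) - f a = h * 'D_v f (a + s *: v).
Proof.
move=> h0 df.
pose phi (t : R) : R := f (a + t *: v).
pose dphi (t : R) : R := 'D_v f (a + t *: v).
have der (t : R) : 0 <= t <= h -> is_derive (t : R^o) (1 : R^o) (phi : R^o -> R^o) (dphi t).
  by move=> th; apply: derivable_line; exact: df.
have [||s + E] := @MVT R phi dphi 0 h h0.
- move=> t; rewrite in_itv/= => /andP[t0 th]; apply: der.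
  by rewrite !ltW.
- apply: derivable_within_continuous => t; rewrite in_itv/= => /der dt.
  exact: ex_derive.
rewrite in_itv/= => /andP[s0 sh]; exists s; first by rewrite !ltW.
by move: E; rewrite /phi /dphi scale0r addr0 subr0 mulrC.
Qed.

(** Two mean value arguments: along [u] for the increment [f (y + h *: v) - f y], then along [v] for
    ['D_u f]. *)
Lemma second_difference f a u v (h : R) : 0 < h ->
  (forall s t, 0 <= s <= h -> 0 <= t <= h ->
     derivable f (a + s *: u + t *: v) u /\
     derivable ('D_u f) (a + s *: u + t *: v) v) ->
  exists s t, [/\ 0 <= s <= h, 0 <= t <= h &
    f (a + h *: u + h *: v) - f (a + h *: u) - (f (a + h *: v) - f a) =
    h * (h * 'D_v ('D_u f) (a + s *: u + t *: v))].
Proof.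
move=> h0 df.
have hh : 0 <= h <= h by rewrite lexx ltW.
have h00 : 0 <= (0 : R) <= h by rewrite lexx ltW.
have df1 s : 0 <= s <= h -> derivable (fun y => f (y + h *: v)) (a + s *: u) u.
  by move=> sh; apply/derivable_translate; have [fu _] := df s h sh hh; exact: fu.
have df0 s : 0 <= s <= h -> derivable f (a + s *: u) u.
  by move=> sh; have [] := df s 0 sh h00; rewrite scale0r addr0.
have [|s sh] := @MVT_line (fun y => f (y + h *: v) - f y) a u h h0.
  by move=> s sh; apply: derivableB; [exact: df1|exact: df0].
rewrite [X in _ = _ * X]deriveB; [|exact: df1|exact: df0].
rewrite derive_translate => E.
have [|t th E2] := @MVT_line ('D_u f) (a + s *: u) v h h0.
  by move=> t th; have [] := df s t sh th.
by exists s, t; split=> //; rewrite -E2 -E [a + _ + _]addrAC subrACA.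
Qed.

(** The second difference is symmetric in [u] and [v], so divided by [h * h] it is a value of both
    mixed derivatives, at two possibly different points near [x]. By continuity each is within
    [e / 2] of its value at [x]. *)
Lemma schwarz f u v x :
  (\forall y \near x, [/\ derivable f y u, derivable f y v,
     derivable ('D_u f) y v & derivable ('D_v f) y u]) ->
  {for x, continuous ('D_v ('D_u f))} -> {for x, continuous ('D_u ('D_v f))} ->
  'D_v ('D_u f) x = 'D_u ('D_v f) x.
Proof.
move=> df c1 c2; apply/eqP; rewrite -subr_eq0 -normr_le0.
apply/ler_addgt0Pl => e e0; rewrite addr0.
have e2 : 0 < e / 2 by rewrite divr_gt0.
have n1 : \forall y \near x, `|'D_v ('D_u f) x - 'D_v ('D_u f) y| < e / 2.
  by move/cvgrPdist_lt : c1 => /(_ _ e2).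
have n2 : \forall y \near x, `|'D_u ('D_v f) x - 'D_u ('D_v f) y| < e / 2.
  by move/cvgrPdist_lt : c2 => /(_ _ e2).
have /nbhs_ballP[d /= d0] : nbhs x (fun y =>
    [/\ [/\ derivable f y u, derivable f y v,
     derivable ('D_u f) y v & derivable ('D_v f) y u],
     `|'D_v ('D_u f) x - 'D_v ('D_u f) y| < e / 2 &
     `|'D_u ('D_v f) x - 'D_u ('D_v f) y| < e / 2]).
  by move: df n1 n2; apply: filterS3 => y df n1 n2; split.
rewrite -ball_normE /= => B.
(* The parallelogram of side parameters at most [h] stays in the ball of radius [d]; the [+ 1] keeps
   the denominator positive when [u] and [v] vanish and makes the bound strict. *)
pose h := d / (`|u| + `|v| + 1).
have h0 : 0 < h by rewrite divr_gt0// ltr_wpDl// addr_ge0.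
have hd (s t : R) : 0 <= s <= h -> 0 <= t <= h -> `|x - (x + s *: u + t *: v)| < d.
  move=> /andP[s0 sh] /andP[t0 th].
  rewrite -addrA opprD addrA subrr add0r normrN.
  rewrite (le_lt_trans (ler_normD _ _))// !normrZ !ger0_norm//.
  have : s * `|u| + t * `|v| <= h * (`|u| + `|v|).
    by rewrite mulrDr lerD// ler_wpM2r.
  move/le_lt_trans; apply.
  rewrite /h mulrAC ltr_pdivrMr ?ltr_wpDl ?addr_ge0//.
  by rewrite ltr_pM2l// ltrDl.
have [|s [t [sh th E1]]] := @second_difference f x u v h h0.
  move=> s t sh th; have [[fu _ fuv _] _ _] := B _ (hd _ _ sh th).
  exact: conj fu fuv.
have hd' (s1 t1 : R) : 0 <= s1 <= h -> 0 <= t1 <= h -> `|x - (x + s1 *: v + t1 *: u)| < d.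
  by move=> ? ?; rewrite addrAC; exact: hd.
have [|s' [t' [sh' th' E2]]] := @second_difference f x v u h h0.
  move=> s' t' sh' th'; have [[_ fv _ fvu] _ _] := B _ (hd' _ _ sh' th').
  exact: conj fv fvu.
have E : 'D_v ('D_u f) (x + s *: u + t *: v) = 'D_u ('D_v f) (x + s' *: v + t' *: u).
  have hn : h != 0 by rewrite gt_eqF.
  have mulhhI (a b : R) : h * (h * a) = h * (h * b) -> a = b.
    by move=> /(mulfI hn)/(mulfI hn).
  apply: mulhhI.
  transitivity (f (x + h *: u + h *: v) - f (x + h *: u) - (f (x + h *: v) - f x) : R).
    exact: esym E1.
  rewrite -[RHS]E2.
  by rewrite [x + h *: v + _]addrAC subrACA.
have [_ A1 _] := B _ (hd _ _ sh th).
have [_ _ A2] := B _ (hd' _ _ sh' th').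
rewrite -E distrC in A2.
apply: (le_trans (ler_distD ('D_v ('D_u f) (x + s *: u + t *: v)) _ _)).
rewrite (splitr e).
by apply: ltW; exact: ltrD A1 A2.
Qed.

End Schwarz.

(** * Closure properties of smooth maps on an open set *)

Section SmoothClosure.
Local Open Scope classical_set_scope.
Local Open Scope ring_scope.
Variables (R : realType) (n : nat) (W : normedModType R) (V : set 'rV[R]_n).
Implicit Types (f g : 'rV[R]_n -> W).

Lemma Ck_cst k (w : W) : Ck k V (fun=> w).
Proof.
have cw (v : W) x : V x -> {for x, continuous (fun _ : 'rV[R]_n => v)}.
  by move=> _; exact: cst_continuous.
elim: k w => [|k IH] w /=; first by split=> // x; exact: cw.
split; first by move=> x; exact: cw.
move=> i; split; first by move=> x _; exact: derivable_cst.
rewrite (_ : 'D__ _ = (fun=> 0)); first exact: IH.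
by apply/funext => x; exact: derive_cst.
Qed.

Hypothesis oV : open V.

Lemma open_near_eq f g x : (forall z, V z -> f z = g z) -> V x ->
  \near x, f x = g x.
Proof.
move=> fg Vx; apply: filterS fg _.
exact: open_nbhs_nbhs.
Qed.

(** Since [V] is open, agreement on [V] is agreement near each of its points, which derivatives
    respect. The inductions below rely on this, because their derivative formulas hold on [V]
    only. *)
Lemma Ck_ext k f g : (forall x, V x -> f x = g x) -> Ck k V f -> Ck k V g.
Proof.
have cfg f' g' : (forall x, V x -> f' x = g' x) ->
    (forall x, V x -> {for x, continuous f'}) ->
    forall x, V x -> {for x, continuous g'}.
  move=> E cf x Vx; rewrite /prop_for /continuous_at -E//.
  have fg_near : \near x, f' x = g' x by exact: open_near_eq.
  exact: (cvg_trans (near_eq_cvg fg_near) (cf x Vx)).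
elim: k f g => [|k IH] f g fg /= [cf df]; first by split=> //; exact: cfg cf.
split; first exact: cfg cf.
move=> i; have [d1 d2] := df i; split.
  by move=> x Vx; apply: near_eq_derivable (d1 x Vx); exact: open_near_eq.
apply: IH d2 => x Vx; apply: near_eq_derive; exact: open_near_eq.
Qed.

Lemma CkD k f g : Ck k V f -> Ck k V g -> Ck k V (fun x => f x + g x).
Proof.
elim: k f g => [|k IH] f g /= [cf df] [cg dg].
  by split=> // x Vx; exact: (cvgD (cf x Vx) (cg x Vx)).
split; first by move=> x Vx; exact: (cvgD (cf x Vx) (cg x Vx)).
move=> i; have [d1 d2] := df i; have [e1 e2] := dg i; split.
  by move=> x Vx; apply: derivableD; [exact: d1|exact: e1].
apply: Ck_ext (IH _ _ d2 e2) => x Vx.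
by rewrite [RHS]deriveD//; [exact: d1|exact: e1].
Qed.

Lemma CkZ k (a : R) f : Ck k V f -> Ck k V (fun x => a *: f x).
Proof.
have cont h x : {for x, continuous h} ->
    {for x, continuous (fun z : 'rV[R]_n => a *: h z : W)}.
  move=> ch; apply: (@cvgZ _ _ _ (nbhs x) _ (fun=> a) h _ _ _ ch).
  exact: cvg_cst.
elim: k f => [|k IH] f /= [cf df].
  by split=> // x Vx; exact: cont (cf x Vx).
split; first by move=> x Vx; exact: cont (cf x Vx).
move=> i; have [d1 d2] := df i; split.
  by move=> x Vx; apply: derivableZ; exact: d1.
apply: Ck_ext (IH _ d2) => x Vx.
by rewrite [RHS]deriveZ//; exact: d1.
Qed.

Lemma smooth_cst (w : W) : smooth V (fun=> w).
Proof. by move=> k; exact: Ck_cst. Qed.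

Lemma smooth_lin (a : R) f g : smooth V f -> smooth V g ->
  smooth V (fun x => a *: f x + g x).
Proof. by move=> sf sg k; apply: CkD => //; exact: CkZ. Qed.

Lemma smooth_sum (I : Type) (r : seq I) (a : I -> R) (f : I -> 'rV[R]_n -> W) :
  (forall i, smooth V (f i)) -> smooth V (fun x => \sum_(i <- r) a i *: f i x).
Proof.
move=> sf; elim: r => [|i r IH].
  by under eq_fun do rewrite big_nil; exact: smooth_cst.
by under eq_fun do rewrite big_cons; exact: smooth_lin.
Qed.

Lemma smooth_derivable f x (i : 'I_n) : smooth V f -> V x ->
  derivable f x (coord_vec R i).
Proof. by move=> /(_ 1%N)[_ /(_ i)[d _]]; exact: d. Qed.

Lemma smooth_derive f (i : 'I_n) : smooth V f ->
  smooth V ('D_(coord_vec R i) f).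
Proof. by move=> sf k; have [_ /(_ i)[]] := sf k.+1. Qed.

Lemma smooth_continuous f x : smooth V f -> V x -> {for x, continuous f}.
Proof. by move=> /(_ 0%N)[c _]; exact: c. Qed.

End SmoothClosure.

Lemma smooth_schwarz (R : realType) (n : nat) (V : set 'rV[R]_n)
    (f : 'rV[R]_n -> R^o) (i j : 'I_n) (x : 'rV[R]_n) :
  open V -> smooth V f -> V x ->
  'D_(coord_vec R i) ('D_(coord_vec R j) f) x =
  'D_(coord_vec R j) ('D_(coord_vec R i) f) x.
Proof.
move=> oV sf Vx.
have sd k : smooth V ('D_(coord_vec R k) f) by exact: smooth_derive.
apply: schwarz.
- have : nbhs x V by exact: open_nbhs_nbhs.
  by apply: filterS => y Vy; split; apply: smooth_derivable Vy.
- by apply: smooth_continuous Vx; exact: smooth_derive.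
- by apply: smooth_continuous Vx; exact: smooth_derive.
Qed.

(** * Algebra of the bilinear form of a Gram matrix *)

Section Inner.
Variables (R : realType) (n : nat) (G : 'M[R]_n).
Implicit Types (u v w : 'rV[R]_n).

Lemma inner_linearl a u v w :
  inner G (a *: u + v) w = a * inner G u w + inner G v w.
Proof. by rewrite /inner !mulmxDl -!scalemxAl !mxE. Qed.

Lemma inner_linearr a u v w :
  inner G u (a *: v + w) = a * inner G u v + inner G u w.
Proof. by rewrite /inner linearP mulmxDr -scalemxAr !mxE. Qed.

Lemma innerDr u v w : inner G u (v + w) = inner G u v + inner G u w.
Proof. by rewrite -[v]scale1r inner_linearr mul1r scale1r. Qed.

Lemma innerNr u v : inner G u (- v) = - inner G u v.
Proof. by rewrite /inner linearN mulmxN mxE. Qed.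

Lemma innerBr u v w : inner G u (v - w) = inner G u v - inner G u w.
Proof. by rewrite innerDr innerNr. Qed.

Lemma innerZr a u v : inner G u (a *: v) = a * inner G u v.
Proof. by rewrite /inner linearZ -scalemxAr mxE. Qed.

Lemma innerZl a u v : inner G (a *: u) v = a * inner G u v.
Proof. by rewrite /inner -!scalemxAl mxE. Qed.

Lemma inner_sum u v :
  inner G u v = \sum_i \sum_j (u 0 i * v 0 j) * G i j.
Proof.
rewrite /inner mxE exchange_big/=; apply: eq_bigr => j _.
rewrite !mxE big_distrl/=; by apply: eq_bigr => i _; rewrite mulrAC.
Qed.

Lemma innerC u v : G^T = G -> inner G u v = inner G v u.
Proof.
move=> sG; rewrite !inner_sum exchange_big/=; apply: eq_bigr => i _.
by apply: eq_bigr => j _; rewrite -{1}sG mxE [v 0 i * _]mulrC.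
Qed.

End Inner.

(** * Linearity of the connection and of its iterates on constant fields *)

Section Connection.
Variables (R : realType) (n : nat) (V : set 'rV[R]_n).
Variables (nabla : vfield R n -> vfield R n -> vfield R n).
Hypotheses (oV : open V) (cn : affine_connection V nabla).
Implicit Types (X Y Z : vfield R n) (x u v w : 'rV[R]_n).

Lemma conn_linearl a X X' Y x : smooth V X -> smooth V X' -> smooth V Y -> V x ->
  nabla (fun z => a *: X z + X' z) Y x = a *: nabla X Y x + nabla X' Y x.
Proof.
move=> sX sX' sY Vx.
have saX : smooth V (fun z => a *: X z) by move=> k; apply: CkZ.
rewrite (conn_addl cn saX)//; congr (_ + _).
by apply: (conn_scalel cn (f := fun=> a)) => //; exact: smooth_cst.
Qed.

Lemma conn_linearr a X Y Y' x : smooth V X -> smooth V Y -> smooth V Y' -> V x ->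
  nabla X (fun z => a *: Y z + Y' z) x = a *: nabla X Y x + nabla X Y' x.
Proof.
move=> sX sY sY' Vx.
have saY : smooth V (fun z => a *: Y z) by move=> k; apply: CkZ.
rewrite (conn_addr cn sX saY)//; congr (_ + _).
rewrite (conn_leibniz cn (f := fun=> a))//; last exact: smooth_cst.
by rewrite derive_cst scale0r add0r.
Qed.

Lemma conn_zerol Y x : smooth V Y -> V x -> nabla (fun=> 0) Y x = 0.
Proof.
move=> sY Vx; have s0 : smooth V (fun=> 0 : 'rV[R]_n) by exact: smooth_cst.
have := conn_linearl (-1) s0 s0 sY Vx.
rewrite (_ : (fun z => _) = (fun=> 0)); first by rewrite scaleN1r addNr.
by apply/funext => z; rewrite scaleN1r addNr.
Qed.

(** This is the plain iterate, not the second covariant derivative: no term in [nabla u v] is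
    subtracted. Constant fields commute, so its skew part in [u], [v] is already the curvature. *)
Definition nabla2 u v w : vfield R n :=
  nabla (fun=> u) (nabla (fun=> v) (fun=> w)).

Let sc u : smooth V (fun=> u) := smooth_cst V u.

Let sn u w : smooth V (nabla (fun=> u) (fun=> w)).
Proof. exact: (conn_smooth cn). Qed.

Lemma nabla2_linear1 a u u' v w x : V x ->
  nabla2 (a *: u + u') v w x = a *: nabla2 u v w x + nabla2 u' v w x.
Proof. by move=> Vx; exact: (conn_linearl a (X := fun=> u) (X' := fun=> u')). Qed.

(** The inner derivative is linear only at points of [V]; [conn_ext] carries that equality through
    the outer derivative. *)
Lemma nabla2_linear2 a u v v' w x : V x ->
  nabla2 u (a *: v + v') w x = a *: nabla2 u v w x + nabla2 u v' w x.
Proof.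
move=> Vx; rewrite /nabla2 -conn_linearr//; apply: (conn_ext cn) => //.
  exact: smooth_lin.
by move=> z Vz; exact: (conn_linearl a (X := fun=> v) (X' := fun=> v')).
Qed.

Lemma nabla2_linear3 a u v w w' x : V x ->
  nabla2 u v (a *: w + w') x = a *: nabla2 u v w x + nabla2 u v w' x.
Proof.
move=> Vx; rewrite /nabla2 -conn_linearr//; apply: (conn_ext cn) => //.
  exact: smooth_lin.
by move=> z Vz; exact: (conn_linearr a (Y := fun=> w) (Y' := fun=> w')).
Qed.

Lemma curvature_atE x u v w : V x ->
  curvature_at nabla x u v w = nabla2 u v w x - nabla2 v u w x.
Proof.
move=> Vx; rewrite /curvature_at /curvature.
rewrite (_ : lie_bracket _ _ = (fun=> 0)); first by rewrite conn_zerol// subr0.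
by apply/funext => z; rewrite /lie_bracket !derive_cst subr0.
Qed.

End Connection.

Lemma linear_coord_sum (R : realType) (n : nat) (f : 'rV[R]_n -> R) :
  (forall a u v, f (a *: u + v) = a * f u + f v) ->
  forall u, f u = \sum_i u 0 i * f (coord_vec R i).
Proof.
move=> fl u; have f0 : f 0 = 0.
  by have := fl (-1) 0 0; rewrite scaler0 addr0 mulN1r addNr.
rewrite {1}(row_sum_delta u); elim/big_rec2: _ => // i a v _ <-.
exact: fl.
Qed.

(** * Multilinearity and skew-symmetries of the curvature tensor *)

Section Riemann.
Variables (R : realType) (n : nat) (V : set 'rV[R]_n) (g : 'rV[R]_n -> 'M[R]_n).
Variables (nabla : vfield R n -> vfield R n -> vfield R n).
Hypotheses (oV : open V) (lc : levi_civita V g nabla).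
Hypothesis gsm : forall i j, smooth V (fun x => g x i j : R^o).
Hypothesis gsym : forall x, V x -> (g x)^T = g x.
Variables (x : 'rV[R]_n) (Vx : V x).
Implicit Types (u v w X Y Z W : 'rV[R]_n).

Let cn := lc_connection lc.
Let sc u : smooth V (fun=> u) := smooth_cst V u.

Local Notation Rm := (riemann g nabla x).

Lemma riemann_linear1 a W W' Z X Y :
  Rm (a *: W + W') Z X Y = a * Rm W Z X Y + Rm W' Z X Y.
Proof. exact: inner_linearl. Qed.

Lemma riemann_linear2 a W Z Z' X Y :
  Rm W (a *: Z + Z') X Y = a * Rm W Z X Y + Rm W Z' X Y.
Proof.
rewrite /riemann -inner_linearr !(curvature_atE oV cn)//.
by rewrite !(nabla2_linear3 oV cn)// scalerBr opprD addrACA.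
Qed.

Lemma riemannC34 W Z X Y : Rm W Z Y X = - Rm W Z X Y.
Proof.
by rewrite /riemann !(curvature_atE oV cn)// -innerNr opprB.
Qed.

Lemma riemann_linear3 a W Z X X' Y :
  Rm W Z (a *: X + X') Y = a * Rm W Z X Y + Rm W Z X' Y.
Proof.
rewrite /riemann -inner_linearr !(curvature_atE oV cn)//.
rewrite (nabla2_linear1 oV cn)// (nabla2_linear2 oV cn)//.
by rewrite scalerBr opprD addrACA.
Qed.

Lemma riemann_linear4 a W Z X Y Y' :
  Rm W Z X (a *: Y + Y') = a * Rm W Z X Y + Rm W Z X Y'.
Proof.
by rewrite riemannC34 riemann_linear3 [Rm W Z Y X]riemannC34
  [Rm W Z Y' X]riemannC34 mulrN -opprD opprK.
Qed.

Lemma smooth_inner W Z : smooth V (fun z => inner (g z) W Z : R^o).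
Proof.
(* The factor [1] gives the outer sum the shape required by [smooth_sum]. *)
rewrite (_ : (fun z => _) =
  (fun z => \sum_i 1 *: (\sum_j (W 0 i * Z 0 j) *: (g z i j : R^o)) : R^o)).
  by apply: smooth_sum => // i; exact: smooth_sum.
apply/funext => z; rewrite inner_sum; apply: eq_bigr => i _.
by rewrite scale1r.
Qed.

(** Metric compatibility is used twice: on [<W,W>] along [j], which gives half its derivative as
    [<W, nabla_j W>], then on that product along [i]. The right-hand side is visibly symmetric in
    [i], [j] once mixed partials commute. *)
Lemma derive_inner_nabla i j W :
  inner (g x) W (nabla2 nabla (coord_vec R i) (coord_vec R j) W x) =
  'D_(coord_vec R i) ('D_(coord_vec R j) (fun z => inner (g z) W W : R^o)) x / 2
  - inner (g x) (nabla (fun=> coord_vec R i) (fun=> W) x)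
                (nabla (fun=> coord_vec R j) (fun=> W) x).
Proof.
set ei := coord_vec R i; set ej := coord_vec R j.
pose phi (z : 'rV[R]_n) : R^o := inner (g z) W W.
have sphi : smooth V phi by exact: smooth_inner.
have sN u : smooth V (nabla (fun=> u) (fun=> W)) by exact: (conn_smooth cn).
have E z : V z -> inner (g z) W (nabla (fun=> ej) (fun=> W) z) =
                  2^-1 *: ('D_ej phi z : R^o).
  move=> Vz; have -> : 'D_ej phi z = _ := lc_metric lc (sc ej) (sc W) (sc W) Vz.
  rewrite [X in X + _]innerC ?gsym//.
  rewrite [RHS](_ : _ = 2^-1 * (inner (g z) W (nabla (fun=> ej) (fun=> W) z)
     + inner (g z) W (nabla (fun=> ej) (fun=> W) z)))//.
  lra.
have := lc_metric lc (sc ei) (sc W) (sN ej) Vx.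
(* [E] holds on the open set [V], hence near [x], so it can be differentiated at [x]. *)
rewrite [LHS](_ : _ = 2^-1 *: ('D_ei ('D_ej phi) x : R^o)); last first.
  rewrite -[RHS]deriveZ; first exact: near_eq_derive (open_near_eq oV E Vx).
  by apply: smooth_derivable Vx; exact: smooth_derive.
move=> E2; apply: (canRL (addrK _)).
by rewrite addrC [RHS]mulrC; exact: esym E2.
Qed.

Lemma riemann_diag_coord i j W : Rm W W (coord_vec R i) (coord_vec R j) = 0.
Proof.
rewrite /riemann (curvature_atE oV cn)// innerBr.
apply/eqP; rewrite subr_eq0; apply/eqP.
rewrite (derive_inner_nabla i j) (derive_inner_nabla j i).
apply: (f_equal2 (fun a b : R => a / 2 - b)); last by rewrite innerC ?gsym.
exact: (smooth_schwarz i j oV (smooth_inner W W) Vx).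
Qed.

(** Polarization: the form vanishes on the diagonal [W = Z], first for coordinate vectors [X], [Y],
    then for all by linearity. *)
Lemma riemannC12 W Z X Y : Rm Z W X Y = - Rm W Z X Y.
Proof.
have diag U : Rm U U X Y = 0.
  rewrite (linear_coord_sum (f := fun v => Rm U U v Y)); last first.
    by move=> a u v; exact: riemann_linear3.
  rewrite big1// => i _.
  rewrite (linear_coord_sum (f := fun v => Rm U U _ v)); last first.
    by move=> a u v; exact: riemann_linear4.
  by rewrite big1 ?mulr0// => j _; rewrite riemann_diag_coord mulr0.
(* The coefficient [1] lets the linearity lemmas, stated for [a *: u + v], expand the sum. *)
have := diag (1 *: W + Z).
rewrite riemann_linear1 !riemann_linear2 !diag; lra.
Qed.

End Riemann.

(** * Orthonormal frames and metric traces *)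

Section Frames.
Variables (R : realType) (n : nat) (G : 'M[R]_n).

Lemma gramE m (P : 'M[R]_(m, n)) i j :
  (P *m G *m P^T) i j = inner G (row i P) (row j P).
Proof. by rewrite /inner tr_row colE !mulmxA -row_mul -row_mul -colE !mxE. Qed.

(** The hypothesis says that the rows of [P] are orthonormal. One-sided inverses of square matrices
    are two-sided, so [P] may be moved from the left end of the product to the right. *)
Lemma invmx_frame (P : 'M[R]_n) : P *m G *m P^T = 1%:M -> invmx G = P^T *m P.
Proof.
move=> PG; have GPP : G *m (P^T *m P) = 1%:M.
  by rewrite mulmxA; apply: mulmx1C; rewrite mulmxA.
have [uG _] := mulmx1_unit GPP.
by rewrite -[RHS](mulKmx uG) GPP mulmx1.
Qed.

(** The products with the frame are the entries of [P *m G *m u^T], and [P *m G] is invertible. *)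
Lemma frame_inner_inj (P : 'M[R]_n) u v : P *m G *m P^T = 1%:M ->
  (forall i, inner G (row i P) u = inner G (row i P) v) -> u = v.
Proof.
move=> PG E; apply: trmx_inj.
have [uPG _] := mulmx1_unit PG.
apply: (can_inj (mulKmx uPG)); apply/matrixP => i j.
by have := E i; rewrite /inner -!row_mul ord1 !mxE.
Qed.

Lemma bilinear_coord_sum (B : 'rV[R]_n -> 'rV[R]_n -> R) :
  (forall a u v w, B (a *: u + v) w = a * B u w + B v w) ->
  (forall a u v w, B u (a *: v + w) = a * B u v + B u w) ->
  forall u v, B u v =
    \sum_i \sum_j (u 0 i * v 0 j) * B (coord_vec R i) (coord_vec R j).
Proof.
move=> Bl Br u v; rewrite (linear_coord_sum (f := B^~ v)) => [|a u' v']; last exact: Bl.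
apply: eq_bigr => i _; rewrite (linear_coord_sum (f := B _)) => [|a u' v']; last exact: Br.
by rewrite mulr_sumr; apply: eq_bigr => j _; rewrite mulrA.
Qed.

(** Turns contractions with the inverse metric into sums over an orthonormal frame: substitute
    [P^T *m P] for the inverse and expand by bilinearity. *)
Lemma trace_frame (B : 'rV[R]_n -> 'rV[R]_n -> R) (P : 'M[R]_n) :
  (forall a u v w, B (a *: u + v) w = a * B u w + B v w) ->
  (forall a u v w, B u (a *: v + w) = a * B u v + B u w) ->
  P *m G *m P^T = 1%:M ->
  \sum_i \sum_j invmx G i j * B (coord_vec R i) (coord_vec R j) =
  \sum_a B (row a P) (row a P).
Proof.
move=> Bl Br PG; rewrite (invmx_frame PG).
under [RHS]eq_bigr => a _ do rewrite (bilinear_coord_sum Bl Br).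
rewrite [RHS]exchange_big/=; apply: eq_bigr => i _.
rewrite [RHS]exchange_big/=; apply: eq_bigr => j _.
by rewrite mxE mulr_suml; apply: eq_bigr => a _; rewrite !mxE.
Qed.

End Frames.

Lemma orthonormal_frame3 (R : realType) (G : 'M[R]_3) (x y : 'rV[R]_3) :
  G^T = G -> (forall u, u != 0 -> 0 < inner G u u) ->
  inner G x x = 1 -> inner G y y = 1 -> inner G x y = 0 ->
  exists P : 'M[R]_3, [/\ row 0 P = x, row 1 P = y & P *m G *m P^T = 1%:M].
Proof.
move=> sG pG xx yy xy.
(* A row killed by [K] is orthogonal to [x] and [y]. Three rows against rank at most two leave a
   nonzero such row, which is then normalised. *)
pose K : 'M[R]_(3, 1 + 1) := G *m (col_mx x y)^T.
have wK : nz_row (kermx K) *m K = 0.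
  by apply/sub_kermxP; exact: nz_row_sub.
have w0 : nz_row (kermx K) != 0.
  by rewrite nz_row_eq0 kermx_eq0 /row_free ltn_eqF// ltnS rank_leq_col.
move: (nz_row _) w0 wK => w w0 wK.
have [wx wy] : inner G w x = 0 /\ inner G w y = 0.
  move: wK; rewrite /K tr_col_mx mul_mx_row mul_mx_row -row_mx0 => /eq_row_mx[].
  by rewrite !mulmxA /inner => -> ->; rewrite !mxE.
have ww := pG _ w0.
pose z := (Num.sqrt (inner G w w))^-1 *: w.
have zz : inner G z z = 1.
  rewrite innerZl innerZr mulrA -expr2 exprVn sqr_sqrtr ?ltW// mulVf//.
  by rewrite gt_eqF.
have zx : inner G z x = 0 by rewrite innerZl wx mulr0.
have zy : inner G z y = 0 by rewrite innerZl wy mulr0.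
pose P : 'M[R]_3 := \matrix_(i < 3) [:: x; y; z]`_i.
exists P; split; [exact: rowK|exact: rowK|].
apply/matrixP => i j; rewrite gramE !rowK mxE.
case: i => [[|[|[|//]]] ?]; case: j => [[|[|[|//]]] ?] //=.
all: by rewrite innerC.
Qed.

(** * Ricci and scalar curvature in an orthonormal frame *)

Section RicciInFrame.
Variables (R : realType) (n : nat) (V : set 'rV[R]_n) (g : 'rV[R]_n -> 'M[R]_n).
Variables (nabla : vfield R n -> vfield R n -> vfield R n).
Hypotheses (oV : open V) (lc : levi_civita V g nabla).
Variables (p : 'rV[R]_n) (Vp : V p) (P : 'M[R]_n).
Hypothesis PG : P *m g p *m P^T = 1%:M.

Local Notation Rm := (riemann g nabla p).

Lemma ricci_frame i k : ricci g nabla p i k =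
  \sum_a Rm (row a P) (coord_vec R i) (row a P) (coord_vec R k).
Proof.
rewrite -(trace_frame (B := fun u v => Rm u _ v _) _ _ PG)// => a u v w.
  exact: riemann_linear1.
exact: (riemann_linear3 oV lc).
Qed.

Lemma ricci_contract (u v : 'rV[R]_n) :
  \sum_i u 0 i * (\sum_k ricci g nabla p i k * v 0 k) =
  \sum_a Rm (row a P) u (row a P) v.
Proof.
have E a : Rm (row a P) u (row a P) v = \sum_i \sum_k (u 0 i * v 0 k) *
    Rm (row a P) (coord_vec R i) (row a P) (coord_vec R k).
  apply: (bilinear_coord_sum (B := fun u v => Rm (row a P) u (row a P) v)).
    by move=> ? ? ? ?; exact: (riemann_linear2 oV lc).
  by move=> ? ? ? ?; exact: (riemann_linear4 oV lc).
under [RHS]eq_bigr do rewrite E.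
rewrite [RHS]exchange_big/=; apply: eq_bigr => i _.
rewrite [RHS]exchange_big/= mulr_sumr; apply: eq_bigr => k _.
by rewrite -mulr_sumr ricci_frame [_ * v 0 k]mulrC mulrA.
Qed.

(** A second use of [trace_frame], on the Ricci form already written as a sum over the frame. *)
Lemma scalar_curvature_frame : scalar_curvature g nabla p =
  \sum_b \sum_a Rm (row a P) (row b P) (row a P) (row b P).
Proof.
rewrite /scalar_curvature.
under eq_bigr => i _ do under eq_bigr => k _ do rewrite ricci_frame.
rewrite (trace_frame (B := fun u v => \sum_a Rm (row a P) u (row a P) v) _ _ PG)//.
- move=> c u v w; rewrite mulr_sumr -big_split/=; apply: eq_bigr => a _.
  exact: (riemann_linear2 oV lc).
- move=> c u v w; rewrite mulr_sumr -big_split/=; apply: eq_bigr => a _.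
  exact: (riemann_linear4 oV lc).
Qed.

Lemma ricci_eigen_frame lam v u : ricci_eigen g nabla p lam v ->
  \sum_a Rm (row a P) u (row a P) v = lam * inner (g p) u v.
Proof.
move=> [_ E]; rewrite -ricci_contract inner_sum mulr_sumr.
apply: eq_bigr => i _; rewrite E mulrCA; congr (_ * _).
by rewrite mulr_sumr; apply: eq_bigr => j _; rewrite mulrAC mulrA.
Qed.

End RicciInFrame.

(** * Curvature components in a frame extending the two Ricci eigenvectors *)

Theorem proposition2 (R : realType) (M : topologicalType)
    (A : smooth_atlas R 3 M) (g : riemannian_metric A)
    (p : M) (c : chart A) (hp : chart_dom c p)
    (nabla : vfield R 3 -> vfield R 3 -> vfield R 3)
    (hnabla : levi_civita (chart_img c) (g c) nabla)
    (lambda mu : R) (x y : 'rV[R]_3)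
    (hx : ricci_eigen (g c) nabla (chart_map c p) lambda x)
    (hy : ricci_eigen (g c) nabla (chart_map c p) mu y)
    (hxx : inner (g c (chart_map c p)) x x = 1)
    (hyy : inner (g c (chart_map c p)) y y = 1)
    (hxy : inner (g c (chart_map c p)) x y = 0) :
  M_eigentriple (g c) nabla (chart_map c p)
    (lambda + mu - scalar_curvature (g c) nabla (chart_map c p) / 2) x y.
Proof.
have oV : open (chart_img c) by exact: chart_img_open.
have Vp : chart_img c (chart_map c p) by exists p.
have gsm := metric_smooth g c.
have gsym := @Defs.metric_sym _ _ _ _ g c.
have [P [Px Py PG]] := orthonormal_frame3 (gsym _ Vp)
  (fun u => @Defs.metric_pos _ _ _ _ g c _ u Vp) hxx hyy hxy.
have C12 := riemannC12 oV hnabla gsm gsym Vp.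
have C34 := riemannC34 oV hnabla Vp.
have ricx u := ricci_eigen_frame oV hnabla Vp PG u hx.
have ricy u := ricci_eigen_frame oV hnabla Vp PG u hy.
have inner_row i j :
    inner (g c (chart_map c p)) (row i P) (row j P) = (i == j)%:R.
  by rewrite -gramE PG mxE.
rewrite (scalar_curvature_frame oV hnabla Vp PG).
(* The indices are spelled as [big_ord_recl] produces them. *)
pose i0 : 'I_3 := ord0; pose i1 : 'I_3 := lift ord0 ord0.
pose i2 : 'I_3 := lift ord0 (lift ord0 ord0).
have ord3 (Q : 'I_3 -> Prop) : Q i0 -> Q i1 -> Q i2 -> forall i, Q i.
  move=> Q0 Q1 Q2 [[|[|[|//]]] ilt]; [move: Q0|move: Q1|move: Q2];
  by congr Q; exact: val_inj.
have sum3 (f : 'I_3 -> R) : \sum_i f i = f i0 + f i1 + f i2.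
  by rewrite !big_ord_recl big_ord0 addr0 addrA.
have {}Px : x = row i0 P by rewrite -Px; congr row; exact: val_inj.
have {}Py : y = row i1 P by rewrite -Py; congr row; exact: val_inj.
pose r i j k l := riemann (g c) nabla (chart_map c p)
  (row i P) (row j P) (row k P) (row l P).
have r12 i j k l : r j i k l = - r i j k l := C12 _ _ _ _.
have r34 i j k l : r i j l k = - r i j k l := C34 _ _ _ _.
have ricx3 i : r i0 i i0 i0 + r i1 i i1 i0 + r i2 i i2 i0 = lambda * (i == i0)%:R.
  by rewrite -inner_row -Px -ricx sum3 Px.
have ricy3 i : r i0 i i0 i1 + r i1 i i1 i1 + r i2 i i2 i1 = mu * (i == i1)%:R.
  by rewrite -inner_row -Py -ricy sum3 Py.
have r0l i k l : r i i k l = 0 by have := r12 i i k l; lra.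
have r0r i j k : r i j k k = 0 by have := r34 i j k k; lra.
have rC i j : r i j i j = r j i j i by rewrite r12 r34 opprK.
(* Each of the three coordinate planes of the frame is counted twice, once per ordering. *)
have SE : \sum_b \sum_a r a b a b =
    2 * (r i1 i0 i1 i0 + r i2 i0 i2 i0 + r i2 i1 i2 i1).
  rewrite !sum3 !r0l (rC i0 i1) (rC i0 i2) (rC i1 i2).
  move: (r i1 i0 i1 i0) (r i2 i0 i2 i0) (r i2 i1 i2 i1) => k1 k2 k3.
  lra.
move: SE; rewrite /r => SE; rewrite {}SE -!/(r _ _ _ _).
(* With sectional curvatures [k1], [k2], [k3] of the planes [xy], [xz], [yz], the Ricci equations
   read [lambda = k1 + k2] and [mu = k1 + k3]. *)
have -> : lambda + mu - 2 * (r i1 i0 i1 i0 + r i2 i0 i2 i0 + r i2 i1 i2 i1) / 2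
    = r i1 i0 i1 i0.
  have := ricx3 i0; have := ricy3 i1.
  rewrite !r0l (rC i0 i1) !eqxx !mulr1.
  move: (r i1 i0 i1 i0) (r i2 i0 i2 i0) (r i2 i1 i2 i1) => k1 k2 k3.
  lra.
(* In [Ric(z,y) = 0] the terms with a repeated index in a skew pair drop out, leaving this component
   up to two sign changes. *)
have z1 : r i2 i0 i1 i0 = 0.
  have := ricy3 i2; rewrite r0r r0l !addr0 mulr0 => E.
  by rewrite r12 r34 opprK.
have z2 : r i2 i1 i0 i1 = 0.
  have := ricx3 i2; rewrite r0r r0l add0r addr0 mulr0 => E.
  by rewrite r12 r34 opprK.
(* Both vector equations are tested against the three frame vectors; the six scalar equations follow
   from skew-symmetry, [rC], [z1] and [z2]. *)
split=> //; apply: (frame_inner_inj PG); apply: ord3;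
  rewrite innerZr Px Py inner_row -[LHS]/(r _ _ _ _) /= ?mulr0 ?mulr1//.
Qed.
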